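(* For each $n$ (large enough that $\lfloor n/2\rfloor -1\geq 1$) let $G=(V,E)$ be a connected graph on $V=\{1,\ldots,n\}$, and let $y_i=\theta_i^*+(v_i^* )^{1/2}\epsilon_i$, $i=1,\ldots,n$, where $\theta^*\in\mathbb{R}^n$, $v^*\in\mathbb{R}_+^n$, and $\epsilon_1,\ldots,\epsilon_n$ are independent with $\mathbb{E}(\epsilon_i)=0$ and $\mathrm{var}(\epsilon_i)=1$. Suppose that $v_i^*=v_0^*$ for all $i=1,\ldots,n$, that $\max_{i=1,\ldots,n}\mathbb{E}(\epsilon_i^4)=O(1)$, and that $\|\epsilon\|_\infty=O_{\mathrm{pr}}(U_n)$ for some positive sequence $U_n$. Let $$\hat v:=\frac{1}{2(\lfloor n/2\rfloor-1)}\sum_{i=1}^{\lfloor n/2\rfloor-1}\{y_{\sigma(2i)}-y_{\sigma(2i-1)}\}^2,$$ where $\sigma(1),\ldots,\sigma(n)$ are the nodes of $G$ in the order in which they are visited by a run of depth-first search on $G$. Then $$|v_0^*-\hat v|=O_{\mathrm{pr}}\left[\frac{v_0^*}{n^{1/2}}+\frac{\{U_n(v_0^* )^{1/2}+\|\theta^*\|_\infty\}\,\|\nabla_G\theta^*\|_1}{n}\right].$$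
   Context: All quantities ($G$, $\theta^*$, $v_0^*$, the law of $\epsilon$, $\sigma$) may depend on $n$. Incidence matrix: $\nabla_G\in\mathbb{R}^{|E|\times n}$ has one row for each edge $e=(e^+,e^-)\in E$ (each undirected edge appears once, with arbitrary orientation), with entry $1$ in column $e^+$, $-1$ in column $e^-$, and $0$ elsewhere; so $\|\nabla_G\theta\|_1=\sum_{(i,j)\in E}|\theta_i-\theta_j|$. Depth-first search: DFS$(G,v)$ labels $v$ as discovered and then, for each $w$ with $(w,v)\in E$ in turn, recursively calls DFS$(G,w)$ if $w$ is not yet labelled. Started at a root node of the connected graph $G$, it visits every node exactly once, and $\sigma(k)$ is the $k$-th node discovered. The root and the run of DFS are chosen without using the data $y$ (e.g. the root is chosen at random). For random variables $X_n$ and positive numbers $a_n$, $X_n=O_{\mathrm{pr}}(a_n)$ means that for every $t>0$ there is $C>0$ such that $\mathrm{pr}(X_n>Ca_n)<t$ for all $n$. $\|\cdot\|_1$ and $\|\cdot\|_\infty$ are the usual $\ell_1$ and $\ell_\infty$ norms. *)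

(* Defs.v *)
From HB Require Import structures.
From mathcomp Require Import all_boot all_order all_algebra.
From mathcomp Require Import all_classical all_reals all_analysis.
Set Implicit Arguments.
Unset Strict Implicit.
Unset Printing Implicit Defensive.
Import Order.TTheory GRing.Theory Num.Theory.
Import numFieldNormedType.Exports.
Local Open Scope classical_set_scope.
Local Open Scope ring_scope.

(* The sample sizes for which the estimator below averages at least one term,
   i.e. [n >= 4]. *)
Definition large (n : nat) : bool := (1 <= n./2 - 1)%N.

(* [X_n = O_pr(a_n)], with [n] ranging over the sample sizes satisfying [D];
   each [X_n] may live on its own probability space. *)
Definition Opr (R : realType) (D : pred nat) (d : nat -> measure_display)
    (T : forall n, measurableType (d n)) (P : forall n, probability (T n) R)
    (X : forall n, T n -> R) (a : nat -> R) : Prop :=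
  forall t : R, 0 < t -> exists2 C : R, 0 < C &
    forall n, D n -> (P n [set w | (C * a n < X n w)%R] < t%:E)%E.

Definition mutually_independent (R : realType) (d : measure_display)
    (T : measurableType d) (P : probability T R) (I : finType)
    (X : I -> {RV P >-> R}) : Prop :=
  forall (J : {set I}) (B : I -> set R),
    (forall i, measurable (B i)) ->
    P [set w | forall i, i \in J -> B i (X i w)]
    = (\prod_(i in J) P (X i @^-1` B i))%E.

(* Independence of a countably valued random element [s] from a random element
   [Y]. Measurability of [s], for the discrete sigma-algebra on [S], is
   included; checking points of [S] suffices by countable additivity. *)
Definition discrete_independent (R : realType) (d d' : measure_display)
    (T : measurableType d) (P : probability T R) (S : countType) (s : T -> S)
    (U : measurableType d') (Y : T -> U) : Prop :=
  (forall x, measurable [set w | s w = x]) /\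
  forall x (B : set U), measurable B ->
    P ([set w | s w = x] `&` Y @^-1` B)
    = (P [set w | s w = x] * P (Y @^-1` B))%E.

Definition connected_graph (V : finType) (e : rel V) : Prop :=
  [/\ symmetric e, irreflexive e & forall x y, connect e x y].

(* [s] lists the nodes in the order of discovery of some run of depth-first
   search: [g v] is the order in which the loop at [v] goes through the
   neighbours of [v]. [fingraph.dfs] pushes each discovered node in front of
   the list of labelled nodes, hence [rev]; its first argument bounds the
   recursion depth, and [#|V|] is enough for the bound never to be reached. *)
Definition dfs_order (V : finType) (e : rel V) (s : seq V) : Prop :=
  exists (g : V -> seq V) (root : V),
    (forall v, perm_eq (g v) (enum (e v))) /\ s = rev (dfs g #|V| [::] root).

(* Each undirected edge once, with [e^+] the endpoint of smaller index. *)
Definition edges (n : nat) (e : rel 'I_n) : {set 'I_n * 'I_n} :=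
  [set p : 'I_n * 'I_n | (p.1 < p.2)%N && e p.1 p.2].

Definition incidence (R : realType) (n : nat) (e : rel 'I_n) :
    'M[R]_(#|edges e|, n) :=
  \matrix_(k, v) ((v == (enum_val k).1)%:R - (v == (enum_val k).2)%:R).

Definition l1norm (R : realType) (n : nat) (x : 'cV[R]_n) : R :=
  \sum_(i < n) `|x i 0|.

Definition observations (R : realType) (n : nat) (theta v eps : 'cV[R]_n) :
    n.-tuple (measurableTypeR R) :=
  [tuple theta i 0 + Num.sqrt (v i 0) * eps i 0 | i < n].

(* Sequences are indexed from 0, so the k-th entry is at position [k.-1]. *)
Definition dfs_variance (R : realType) (n : nat) (y : n.-tuple R)
    (s : seq 'I_n) : R :=
  let m := (n./2 - 1)%N in
  let z := [seq tnth y j | j <- s] in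
  (2 * m%:R)^-1 *
    \sum_(1 <= i < m.+1) (z`_(2 * i).-1 - z`_(2 * i - 1).-1) ^+ 2.

(* Main.v *)
(* For a fixed discovery order s write y_{s(2i)} - y_{s(2i-1)} = D_i + v0^{1/2} d_i
   with D_i a difference of theta and d_i one of eps. The terms involving D_i are
   at most |D_i| times a uniform bound, and sum_i |D_i| <= 2 |nabla theta|_1:
   the search walks through a spanning tree and uses each of its edges at most
   twice. What remains is v0 times the average of the d_i^2 - 2. Written as
   (eps_b^2 - 1) + (eps_a^2 - 1) - 2 eps_a eps_b it is a combination of three
   orthogonal families, so its variance is O(1/n) by independence, and
   Chebyshev's inequality applies. The bound does not depend on s, and sigma is
   independent of y, so it survives averaging over the values of sigma. *)

Require Import Defs.
From HB Require Import structures.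
From mathcomp Require Import all_boot all_order all_algebra.
From mathcomp Require Import all_classical all_reals all_analysis.
From mathcomp Require Import measurable_realfun ring lra zify.
Set Implicit Arguments.
Unset Strict Implicit.
Unset Printing Implicit Defensive.
Import Order.TTheory GRing.Theory Num.Theory.
Import numFieldNormedType.Exports.
Local Open Scope classical_set_scope.
Local Open Scope ring_scope.

(** * Total variation along a depth-first search *)

Fixpoint path_tv (R : realFieldType) (V : Type) (f : V -> R) (x : V) (p : seq V)
    : R :=
  if p is y :: q then `|f y - f x| + path_tv f y q else 0.

Lemma path_tv_cat (R : realFieldType) (V : Type) (f : V -> R) x p y q :
  path_tv f x (p ++ y :: q) =
  path_tv f x p + `|f y - f (last x p)| + path_tv f y q.
Proof.
by elim: p x => [|z p IH] x /=; rewrite ?add0r// IH !addrA.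
Qed.

(** The sum runs over ordered pairs, so for a symmetric [e] and a duplicate-free [s] each edge
    counts twice. This doubling pays for walking along a tree edge in both directions. *)
Definition induced_tv (R : realFieldType) (V : Type) (e : rel V) (f : V -> R)
    (s : seq V) : R :=
  \sum_(a <- s) \sum_(b <- s | e a b) `|f a - f b|.

(** The edge joining the blocks is counted once as [(x, w)] and once as [(w, x)]. The other cross
    terms are nonnegative and are dropped. *)
Lemma induced_tv_cat (R : realFieldType) (V : eqType) (e : rel V) (f : V -> R)
    (s t : seq V) (x w : V) :
  symmetric e -> x \in s -> w \in t -> e x w ->
  induced_tv e f s + induced_tv e f t + `|f w - f x| *+ 2
    <= induced_tv e f (s ++ t).
Proof.
move=> esym xs wt exw; rewrite /induced_tv big_cat/=.
have -> (u : seq V) : \sum_(a <- u) \sum_(b <- s ++ t | e a b) `|f a - f b| =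
   \sum_(a <- u) \sum_(b <- s | e a b) `|f a - f b| +
   \sum_(a <- u) \sum_(b <- t | e a b) `|f a - f b|.
  by rewrite -big_split; apply: eq_bigr => a _; rewrite big_cat.
have cross (u v : seq V) (a b : V) : a \in u -> b \in v -> e a b ->
    `|f a - f b| <= \sum_(a <- u) \sum_(b <- v | e a b) `|f a - f b|.
  move=> au bv eab; rewrite (big_rem a)//= (big_rem b)//= eab -addrA lerDl.
  by rewrite addr_ge0// ?sumr_ge0// => *; rewrite sumr_ge0.
have h1 := cross s t _ _ xs wt exw.
have h2 := cross t s w x wt xs (etrans (esym _ _) exw).
rewrite [X in _ <= _ + X](_ : _ =
    \sum_(a <- t) \sum_(b <- s | e a b) `|f a - f b| +
    \sum_(a <- t) \sum_(b <- t | e a b) `|f a - f b|); last first.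
  by rewrite -big_split; apply: eq_bigr => a _; rewrite big_cat.
move: h1 h2; rewrite (distrC (f x)); set S1 := bigop _ _ _; set S2 := bigop _ _ _.
set S3 := bigop _ _ _; set S4 := bigop _ _ _ => h1 h2; lra.
Qed.

(* Invariant of the search: a call on an undiscovered node [x] appends a block
   [x :: p] whose closed tour [x, p, x] costs at most the (doubled) variation of
   [f] over the edges inside the block. *)
Lemma dfs_path_tv (R : realFieldType) (V : finType) (e : rel V) (f : V -> R)
    (g : V -> seq V) k v x :
  symmetric e -> (forall y, {subset g y <= e y}) ->
  dfs g k v x = v \/
  exists2 p, dfs g k v x = catrev (x :: p) v &
    path_tv f x p + `|f x - f (last x p)| <= induced_tv e f (x :: p).
Proof.
move=> esym ge; elim: k v x => [|k IH] v x /=; first by case: ifP; left.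
case: ifP => _; [by left|right].
(* The loop over the neighbours of [x], generalised so that it may start from a block [x :: p]
   already built; the call itself starts with [p] empty. *)
suff H (ws : seq V) p : {subset ws <= e x} ->
    path_tv f x p + `|f x - f (last x p)| <= induced_tv e f (x :: p) ->
    exists2 q, foldl (dfs g k) (catrev (x :: p) v) ws = catrev (x :: q) v &
    path_tv f x q + `|f x - f (last x q)| <= induced_tv e f (x :: q).
  apply: (H (g x) [::]) => /=; first exact: ge.
  rewrite subrr normr0 addr0; apply: sumr_ge0 => a _; exact: sumr_ge0.
elim: ws p => [|w ws IHws] p sub Hp /=; first by exists p.
have sub' : {subset ws <= e x} by move=> z zw; apply: sub; rewrite inE zw orbT.
have exw : e x w by apply: sub; rewrite inE eqxx.
have [->|[q -> Hq]] := IH (catrev (x :: p) v) w; first exact: IHws.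
rewrite (_ : catrev _ _ = catrev (x :: (p ++ w :: q)) v); last first.
  by rewrite -[x :: (p ++ _)]/((x :: p) ++ _) catrev_catl.
apply: IHws => //.
have := @induced_tv_cat _ _ _ f (x :: p) (w :: q) x w esym
  (mem_head _ _) (mem_head _ _) exw.
rewrite cat_cons; apply: le_trans.
(* The new tour is compared with the tours of [x :: p] and [w :: q] linked by the edge from [x] to
   [w] and back: the triangle inequality through [f x] handles the jump into [w], the one through
   [f w] the return to [x]. *)
rewrite path_tv_cat last_cat /=.
apply: le_trans (lerD (lerD Hp Hq) (lexx _)).
have := ler_distD (f x) (f w) (f (last x p)).
have := ler_distD (f w) (f x) (f (last w q)).
rewrite (distrC (f x) (f w)); lra.
Qed.

Lemma dfs_uniq (V : finType) (g : V -> seq V) k v x :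
  uniq v -> uniq (dfs g k v x).
Proof.
elim: k v x => [|k IH] v x uv /=; first by case: ifP.
case: ifPn => // xv.
have : uniq (x :: v) by rewrite /= xv.
by elim: (g x) (x :: v) => //= w ws IHws u uu; apply/IHws/IH.
Qed.

Lemma dfs_order_perm (V : finType) (e : rel V) (s : seq V) :
  connected_graph e -> dfs_order e s -> perm_eq s (enum V).
Proof.
move=> [_ _ conn] [g [r [ge ->]]].
apply: uniq_perm; rewrite ?rev_uniq ?dfs_uniq ?enum_uniq// => y.
rewrite mem_rev mem_enum inE; apply/dfsP.
have /connectP[p ep ->] := conn r y; exists p => //.
rewrite (eq_path (e' := e))// => a b /=.
by rewrite (perm_mem (ge a)) mem_enum.
Qed.

Lemma dfs_order_path_tv (R : realFieldType) (V : finType) (e : rel V)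
    (f : V -> R) (s : seq V) :
  symmetric e -> dfs_order e s ->
  exists x p, s = x :: p /\ path_tv f x p <= induced_tv e f (x :: p).
Proof.
move=> esym [g [r [ge ->]]].
have ge' y : {subset g y <= e y} by move=> z; rewrite (perm_mem (ge y)) mem_enum.
(* The first alternative would leave the list empty, although the root is discovered. In the second,
   the cost of returning to the root is dropped. *)
have [h|[p -> Hp]] := dfs_path_tv f #|V| [::] r esym ge'.
  have : r \in dfs g #|V| [::] r by apply/dfsP; exists [::].
  by rewrite h.
exists r, p; split; first by rewrite -[catrev _ _]/(rev (r :: p)) revK.
by apply: le_trans Hp; rewrite lerDl.
Qed.

Lemma path_tv_nth (R : realFieldType) (V : Type) (f : V -> R) x p :
  path_tv f x p = \sum_(0 <= k < size p)
    `|[seq f z | z <- x :: p]`_k.+1 - [seq f z | z <- x :: p]`_k|.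
Proof.
elim: p x => [|y p IH] x; first by rewrite /= big_nil.
by rewrite big_nat_recl//= IH.
Qed.

(** The largest even index used is [2 * m - 2], which is below [N] as soon as [2 * m <= N.+1]. The
    slack of one fits a walk on [N.+1] nodes, which has [N] steps. *)
Lemma sum_even_le (R : realFieldType) (F : nat -> R) (m N : nat) :
  (2 * m <= N.+1)%N -> (forall k, 0 <= F k) ->
  \sum_(0 <= i < m) F (2 * i)%N <= \sum_(0 <= k < N) F k.
Proof.
elim: m N => [|m IH] N mN F0; first by rewrite big_nil sumr_ge0.
rewrite big_nat_recr//=.
have [mN'|Nm] := ltnP (2 * m) N; last by lia.
rewrite (big_cat_nat (n := (2 * m)%N) (leq0n _) (ltnW mN'))/=.
apply: lerD; first by apply: IH => //; lia.
by rewrite big_ltn// lerDl sumr_ge0.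
Qed.

Lemma sum_pairs_le_dfs (R : realFieldType) (V : finType) (e : rel V)
    (f : V -> R) (s : seq V) (m : nat) :
  connected_graph e -> dfs_order e s -> (2 * m <= #|V|)%N ->
  \sum_(0 <= i < m)
    `|[seq f z | z <- s]`_(2 * i).+1 - [seq f z | z <- s]`_(2 * i)| <=
  \sum_a \sum_(b | e a b) `|f a - f b|.
Proof.
move=> ce ds mV; have ps := dfs_order_perm ce ds.
have [esym _ _] := ce.
have [x [p [sE]]] := dfs_order_path_tv f esym ds.
rewrite -sE path_tv_nth -sE => H.
(* A search order of a connected graph is a permutation of all nodes, so the induced variation is
   that of the whole graph. *)
have -> : \sum_a \sum_(b | e a b) `|f a - f b| = induced_tv e f s.
  rewrite /induced_tv (perm_big _ ps) big_enum/=; apply: eq_bigr => a _.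
  by rewrite (perm_big _ ps) big_enum_cond.
apply: le_trans H; apply: (sum_even_le (F := fun k => `|_`_k.+1 - _`_k|)) => //.
by rewrite -[(size p).+1]/(size (x :: p)) -sE (perm_size ps) -cardT.
Qed.

Lemma sum_edge_tv (R : realType) (n : nat) (e : rel 'I_n) (theta : 'cV[R]_n) :
  symmetric e -> irreflexive e ->
  \sum_a \sum_(b | e a b) `|theta a 0 - theta b 0| =
  l1norm (incidence R e *m theta) *+ 2.
Proof.
move=> esym eirr.
have inc k : (incidence R e *m theta) k 0 =
    theta (enum_val k).1 0 - theta (enum_val k).2 0.
  rewrite mxE; under eq_bigr do rewrite mxE mulrBl.
  have pick j : \sum_i (i == j)%:R * theta i 0 = theta j 0.
    rewrite (bigD1 j)//= eqxx mul1r big1 ?addr0// => i /negPf ->.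
    by rewrite mul0r.
  by rewrite sumrB !pick.
have -> : l1norm (incidence R e *m theta) =
    \sum_(p in edges e) `|theta p.1 0 - theta p.2 0|.
  by rewrite big_enum_val; apply: eq_bigr => k _; rewrite inc.
rewrite pair_big_dep/= (bigID (fun p : 'I_n * 'I_n => (p.1 < p.2)%N))/= mulr2n.
congr (_ + _).
  by apply: eq_bigl => -[a b]; rewrite inE /= andbC.
(* Swapping the endpoints maps the remaining half onto [edges e]; the diagonal contributes nothing
   because [e] is irreflexive. *)
rewrite (reindex_inj (inv_inj (f := fun p : 'I_n * 'I_n => (p.2, p.1)) _))/=;
  last by case.
apply: eq_big => [[a b]|[a b] _] /=; last exact: distrC.
rewrite inE/= (esym b).
by case: (ltngtP a b) => [||/val_inj->]; rewrite ?andbT ?andbF ?eirr.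
Qed.

(** * Expectations of products of independent variables *)

Import HBNNSimple.

(** The hypothesis is the case of indicators; simple functions follow by linearity and [g] by
    monotone convergence. In the application [F] is the product of all factors but one and [c] its
    expectation. *)
Lemma ge0_integralM_indep (R : realType) (d : measure_display)
    (T : measurableType d) (P : probability T R) (F : T -> R)
    (X : {RV P >-> R}) (c : \bar R) (g : R -> R) :
  measurable_fun setT F -> (forall w, 0 <= F w) -> c \is a fin_num ->
  (forall B, measurable B ->
    \int[P]_w (F w * \1_B (X w))%:E = c * P (X @^-1` B))%E ->
  measurable_fun [set: R] g -> (forall x, 0 <= g x) ->
  (\int[P]_w (F w * g (X w))%:E = c * \int[P]_w (g (X w))%:E)%E.
Proof.
move=> mF F0 cfin H mg g0.
have mgE : measurable_fun [set: R] (fun x : R => (g x)%:E) by exact/measurable_EFinP.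
have mX : measurable_fun setT X by [].
pose h := nnsfun_approx measurableT mgE.
have mh n : measurable_fun setT (h n \o X) by exact: measurableT_comp.
have hcvg x : (h n x)%:E @[n --> \oo] --> (g x)%:E.
  exact: (@cvg_nnsfun_approx _ _ _ _ measurableT _ mgE (fun x _ => g0 x) x).
have hnd : nondecreasing_seq (h : (R -> R)^nat) by exact: nd_nnsfun_approx.
have lim1 : (\int[P]_w (F w * h n (X w))%:E)%E @[n --> \oo] -->
    (\int[P]_w (F w * g (X w))%:E)%E.
  rewrite [X in _ --> X](_ : _ =
      (\int[P]_w limn (fun n => (F w * h n (X w))%:E))%E); last first.
    apply: eq_integral => w _; apply/esym/cvg_lim => //.
    under eq_fun do rewrite EFinM; rewrite EFinM.
    exact: cvgeZl.
  apply: cvg_monotone_convergence => //.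
  - by move=> m; apply/measurable_EFinP; apply: measurable_funM => //; exact: mh.
  - by move=> m w _; rewrite lee_fin mulr_ge0.
  - by move=> w _ m k mk; rewrite lee_fin ler_wpM2l//; exact/lefP/hnd.
have lim2 : (c * \int[P]_w (h n (X w))%:E)%E @[n --> \oo] -->
    (c * \int[P]_w (g (X w))%:E)%E.
  apply: cvgeZl => //.
  rewrite [X in _ --> X](_ : _ =
      (\int[P]_w limn (fun n => (h n (X w))%:E))%E); last first.
    by apply: eq_integral => w _; exact/esym/cvg_lim.
  apply: cvg_monotone_convergence => //.
  - by move=> m; apply/measurable_EFinP; exact: mh.
  - by move=> m w _; rewrite lee_fin.
  - by move=> w _ m k mk; rewrite lee_fin; exact/lefP/hnd.
suff Eh n : (\int[P]_w (F w * h n (X w))%:E = c * \int[P]_w (h n (X w))%:E)%E.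
  by move: lim1; under eq_fun do rewrite Eh; move=> lim1; exact: cvg_unique lim1 lim2.
have mA (y : R) : measurable (h n @^-1` [set y]).
  by rewrite -[X in measurable X]setTI; exact: measurable_funP.
(* Splits the integral over the finitely many values of [h n]. It is used both for [F] and for the
   constant 1. *)
have E (G : T -> R) : measurable_fun setT G -> (forall w, 0 <= G w) ->
    (\int[P]_w (G w * h n (X w))%:E = \sum_(y \in range (h n))
       y%:E * \int[P]_w (G w * \1_(h n @^-1` [set y]) (X w))%:E)%E.
  move=> mG G0.
  have mi y : measurable_fun setT (fun w => (G w * \1_(h n @^-1` [set y]) (X w))%:E).
    apply/measurable_EFinP/measurable_funM => //.
    exact: (measurableT_comp (measurable_indic (mA y)) mX).
  transitivity (\int[P]_w (\sum_(y \in range (h n))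
      (y * (G w * \1_(h n @^-1` [set y]) (X w)))%:E))%E.
    apply: eq_integral => w _; rewrite (fimfunE (h n)) fsumEFin//; congr EFin.
    rewrite !fsbig_finite//= mulr_sumr; apply: eq_bigr => y _.
    by rewrite mulrCA.
  have p0 y w : 0 <= y * (G w * \1_(h n @^-1` [set y]) (X w)).
    rewrite mulrCA mulr_ge0// indicE; case: (boolP (_ \in _)) => [|_]; last by rewrite mulr0.
    by rewrite inE /= => <-; rewrite mulr1.
  rewrite ge0_integral_fsum//; last 2 first.
  - by move=> y; under eq_fun do rewrite EFinM; apply: measurable_funeM.
  - by move=> y w _; rewrite lee_fin.
  apply: eq_fsbigr => y; rewrite inE => -[x _ <-].
  under eq_integral do rewrite EFinM.
  by rewrite ge0_integralZl_EFin// => w _; rewrite lee_fin mulr_ge0.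
have indE (B : set R) : measurable B ->
    (\int[P]_w (\1_B (X w))%:E = P (X @^-1` B))%E.
  move=> mB; rewrite -[X in P X]setIT -integral_indic//; last first.
    by rewrite -[X in measurable X]setTI; exact: mX.
have m1 : measurable_fun [set: T] (fun=> 1 : R) by exact: measurable_cst.
have := E _ m1 (fun=> ler01).
under eq_integral do rewrite mul1r.
under eq_fsbigr do (under eq_integral do rewrite mul1r).
rewrite E// => ->; rewrite ge0_mule_fsumr.
  by apply: eq_fsbigr => y _; rewrite H// indE// muleCA.
(* Each term has to be nonnegative for [c] to move inside the sum; a negative [y] is never a value
   of [h n], so its preimage is empty. *)
move=> y; rewrite indE//; have [y0|y0] := leP 0 y; first by rewrite mule_ge0.
rewrite (_ : _ @^-1` _ = set0) ?measure0 ?mule0//.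
apply/seteqP; split => // w /= hy; move: y0.
by rewrite -hy ltNge fun_ge0.
Qed.

(* By induction on the number of factors that are not indicators: independence
   is the case of indicators only, and monotone convergence frees one factor. *)
Lemma ge0_integral_prod_indep (R : realType) (d : measure_display)
    (T : measurableType d) (P : probability T R) (I : finType)
    (X : I -> {RV P >-> R}) (f : I -> R -> R) :
  mutually_independent X ->
  (forall i, measurable_fun [set: R] (f i)) -> (forall i x, 0 <= f i x) ->
  (forall i, (\int[P]_w (f i (X i w))%:E)%E \is a fin_num) ->
  (\int[P]_w (\prod_i f i (X i w))%:E = \prod_i \int[P]_w (f i (X i w))%:E)%E.
Proof.
move=> indep mf f0 ff.
suff H (s : seq I) : (forall i, i \notin s ->
    exists2 B : set R, measurable B & f i = \1_B) ->
  (\int[P]_w (\prod_i f i (X i w))%:E = \prod_i \int[P]_w (f i (X i w))%:E)%E.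
  by apply: (H (enum I)) => i; rewrite mem_enum.
have indE i (B : set R) : measurable B ->
    (\int[P]_w (\1_B (X i w))%:E = P (X i @^-1` B))%E.
  move=> mB; rewrite -[X in P X]setIT -integral_indic//.
  by rewrite -[X in measurable X]setTI; exact: measurable_funP.
elim: s f mf f0 ff => [|j s IH] f mf f0 ff hf.
  have /choice[B HB] i : exists B : set R, measurable B /\ f i = \1_B.
    by have [B ? ?] := hf i isT; exists B.
  have mB i : measurable (B i) by have [] := HB i.
  (* With indicators only, the claim is independence for the full index set. *)
  have := indep [set: I]%SET B mB.
  under eq_bigl do rewrite inE.
  have -> : [set w | forall i, i \in [set: I]%SET -> B i (X i w)] =
            [set w | forall i, B i (X i w)].
    by apply/seteqP; split => w /= h i; [apply: h; rewrite inE|].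
  have -> : (\prod_i P (X i @^-1` B i) = \prod_i \int[P]_w (f i (X i w))%:E)%E.
    by apply: eq_bigr => i _; have [_ ->] := HB i; rewrite indE.
  have mS : measurable [set w | forall i, B i (X i w)].
    rewrite (_ : [set w | _] = \big[setI/setT]_(i <- enum I) X i @^-1` B i).
      apply: bigsetI_measurable => i _.
      by rewrite -[X in measurable X]setTI; exact: measurable_funP.
    rewrite -bigcap_seq; apply/seteqP; split => w /= h i; first by move=> _; exact: h.
    by apply: h => /=; rewrite mem_enum.
  move=> <-; rewrite -[X in P X]setIT -integral_indic//.
  apply: eq_integral => w _; congr EFin; rewrite indicE.
  case: (boolP (w \in _)) => [|/negP wS].
    by rewrite inE /= => h; rewrite big1// => i _; have [_ ->] := HB i; rewrite indicE mem_set.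
  have [i hi] : exists i, ~ B i (X i w).
    by apply/existsNP => h; apply: wS; rewrite inE.
  by rewrite (bigD1 i)//=; have [_ ->] := HB i; rewrite indicE memNset// mul0r.
pose c := (\prod_(i | i != j) \int[P]_w (f i (X i w))%:E)%E.
have cfin : c \is a fin_num by exact: prode_fin_num.
rewrite (bigD1 j)//= -/c muleC.
under eq_integral do rewrite (bigD1 j)//= mulrC.
apply: ge0_integralM_indep => //.
- under eq_fun do rewrite -big_filter.
  by apply: measurable_prod => i _; exact: measurableT_comp.
- by move=> w; rewrite prodr_ge0.
(* Replacing the factor [j] by an indicator leaves one non-indicator fewer, so the induction
   hypothesis applies to [f']. *)
move=> B mB; pose f' i := if i == j then \1_B else f i.
have f'j : f' j = \1_B by rewrite /f' eqxx.
have IHf' : (\int[P]_w (\prod_i f' i (X i w))%:E = \prod_i \int[P]_w (f' i (X i w))%:E)%E.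
  apply: IH => i.
  - rewrite /f'; case: ifP => _ //; exact: measurable_indic.
  - by move=> x; rewrite /f'; case: ifP => _ //; rewrite indicE.
  - rewrite /f'; case: ifP => _ //; rewrite indE// fin_num_measure//.
    by rewrite -[X in measurable X]setTI; exact: measurable_funP.
  - move=> si; rewrite /f'; case: (eqVneq i j) => [_|ij]; first by exists B.
    by apply: hf; rewrite inE negb_or ij.
have f'E i : i != j -> f' i = f i by rewrite /f' => /negPf ->.
rewrite (bigD1 j)//= f'j indE// muleC in IHf'.
rewrite (eq_bigr (fun i => \int[P]_w (f i (X i w))%:E)%E) in IHf'; last first.
  by move=> i /f'E ->.
rewrite -IHf'; apply: eq_integral => w _; congr EFin.
rewrite [RHS](bigD1 j)//= f'j mulrC; congr (_ * _).
by apply: eq_bigr => i /f'E ->.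
Qed.

Lemma integrable_prod_indep (R : realType) (d : measure_display)
    (T : measurableType d) (P : probability T R) (I : finType)
    (X : I -> {RV P >-> R}) (f : I -> R -> R) :
  mutually_independent X ->
  (forall i, measurable_fun [set: R] (f i)) ->
  (forall i, P.-integrable setT (fun w => (f i (X i w))%:E)) ->
  P.-integrable setT (fun w => (\prod_i f i (X i w))%:E).
Proof.
move=> indep mf fi; apply/integrableP; split.
  apply/measurable_EFinP; apply: measurable_prod => i _.
  exact: measurableT_comp.
under eq_integral do rewrite /= normr_prod.
have fin i : (\int[P]_w (`|f i (X i w)|)%:E)%E \is a fin_num.
  by have := integrable_fin_num measurableT (integrable_abse (fi i)).
rewrite (ge0_integral_prod_indep (f := fun i x => `|f i x|))//.
  by rewrite ltey_eq; apply/orP; left; exact: prode_fin_num.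
by move=> i; exact: measurableT_comp.
Qed.

(** Induction on the number of factors of unknown sign: one such factor is split into its positive
    and negative parts, and both sides are linear in it. *)
Lemma Rintegral_prod_indep (R : realType) (d : measure_display)
    (T : measurableType d) (P : probability T R) (I : finType)
    (X : I -> {RV P >-> R}) (f : I -> R -> R) :
  mutually_independent X ->
  (forall i, measurable_fun [set: R] (f i)) ->
  (forall i, P.-integrable setT (fun w => (f i (X i w))%:E)) ->
  \int[P]_w (\prod_i f i (X i w)) = \prod_i \int[P]_w f i (X i w).
Proof.
move=> indep mf fi.
suff H (s : seq I) : (forall i, i \notin s -> forall x, 0 <= f i x) ->
  \int[P]_w (\prod_i f i (X i w)) = \prod_i \int[P]_w f i (X i w).
  by apply: (H (enum I)) => i; rewrite mem_enum.
elim: s f mf fi => [|j s IH] f mf fi f0.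
  rewrite /Rintegral (ge0_integral_prod_indep (f := f))//; last 2 first.
  - by move=> i x; exact: f0.
  - by move=> i; exact: integrable_fin_num.
  rewrite (eq_bigr (fun i => (\int[P]_w f i (X i w))%:E)); last first.
    by move=> i _; rewrite /Rintegral fineK//; exact: integrable_fin_num.
  by rewrite prodEFin.
pose upd g i := if i == j then g : R -> R else f i.
have updj g : upd g j = g by rewrite /upd eqxx.
have updE g i : i != j -> upd g i = f i by rewrite /upd => /negPf ->.
pose p (x : R) : R := Num.max (f j x) 0; pose q (x : R) : R := Num.max (- f j x) 0.
have mp : measurable_fun [set: R] p by exact: measurable_maxr.
have mq : measurable_fun [set: R] q.
  by apply: measurable_maxr => //; exact: measurableT_comp.
have fpq x : f j x = p x - q x by rewrite /p /q; case: (leP (f j x) 0); case: (leP (- f j x) 0); lra.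
have dom (g : R -> R) : measurable_fun [set: R] g -> (forall x, `|g x| <= `|f j x|) ->
    P.-integrable setT (fun w => (g (X j w))%:E).
  move=> mg gf; apply: le_integrable (fi j) => //.
    by apply/measurable_EFinP; exact: measurableT_comp.
  by move=> w _; rewrite lee_fin.
have ip : P.-integrable setT (fun w => (p (X j w))%:E).
  by apply: dom => // x; rewrite /p; case: (leP (f j x) 0) => h; rewrite ?normr0.
have iq : P.-integrable setT (fun w => (q (X j w))%:E).
  by apply: dom => // x; rewrite /q; case: (leP (- f j x) 0) => h; rewrite ?normr0 ?normrN.
have updm (g : R -> R) : measurable_fun [set: R] g -> forall i, measurable_fun [set: R] (upd g i).
  by move=> mg i; rewrite /upd; case: ifP.
have updi (g : R -> R) : P.-integrable setT (fun w => (g (X j w))%:E) ->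
    forall i, P.-integrable setT (fun w => (upd g i (X i w))%:E).
  by move=> ig i; rewrite /upd; case: (eqVneq i j) => [->|].
have updI (g : R -> R) : measurable_fun [set: R] g -> (forall x, 0 <= g x) ->
    P.-integrable setT (fun w => (g (X j w))%:E) ->
    \int[P]_w (g (X j w) * \prod_(i | i != j) f i (X i w)) =
    \int[P]_w g (X j w) * \prod_(i | i != j) \int[P]_w f i (X i w).
  move=> mg g0 ig.
  have g0' i : i \notin s -> forall x, 0 <= upd g i x.
    move=> si x; rewrite /upd; case: (eqVneq i j) => [//|ij].
    by apply: f0; rewrite inE negb_or ij.
  transitivity (\int[P]_w (\prod_i upd g i (X i w))).
    apply: eq_Rintegral => w _; rewrite [RHS](bigD1 j)//= updj; congr (_ * _).
    by apply: eq_bigr => i ij; rewrite updE.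
  rewrite (IH _ (updm _ mg) (updi _ ig) g0') (bigD1 j)//= updj; congr (_ * _).
  by apply: eq_bigr => i ij; rewrite updE.
have ppos x : 0 <= p x by rewrite le_max lexx orbT.
have qpos x : 0 <= q x by rewrite le_max lexx orbT.
have updP (g : R -> R) : measurable_fun [set: R] g ->
    P.-integrable setT (fun w => (g (X j w))%:E) ->
    P.-integrable setT (fun w => (g (X j w) * \prod_(i | i != j) f i (X i w))%:E).
  move=> mg ig; apply: eq_integrable (integrable_prod_indep indep (updm _ mg) (updi _ ig)) => // w _.
  rewrite (bigD1 j)//= updj; congr (_ * _)%:E.
  by apply: eq_bigr => i ij; rewrite updE.
rewrite [RHS](bigD1 j)//=.
under [LHS]eq_Rintegral do rewrite (bigD1 j)//= fpq mulrBl.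
rewrite RintegralB//; [|exact: updP|exact: updP].
rewrite !updI// -mulrBl; congr (_ * _).
under [RHS]eq_Rintegral do rewrite fpq.
by rewrite RintegralB.
Qed.

(** Factors outside [s] are set to the constant 1, which reduces the claim to the product over all
    of [I]. *)
Lemma prod_seq_indep (R : realType) (d : measure_display)
    (T : measurableType d) (P : probability T R) (I : finType)
    (X : I -> {RV P >-> R}) (f : I -> R -> R) (s : seq I) :
  mutually_independent X -> uniq s ->
  (forall i, measurable_fun [set: R] (f i)) ->
  (forall i, P.-integrable setT (fun w => (f i (X i w))%:E)) ->
  P.-integrable setT (fun w => (\prod_(i <- s) f i (X i w))%:E) /\
  \int[P]_w (\prod_(i <- s) f i (X i w)) = \prod_(i <- s) \int[P]_w f i (X i w).
Proof.
move=> indep us mf fi.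
pose f' i := if i \in s then f i else fun=> 1 : R.
have mf' i : measurable_fun [set: R] (f' i) by rewrite /f'; case: ifP.
have fi' i : P.-integrable setT (fun w => (f' i (X i w))%:E).
  by rewrite /f'; case: ifP => // _; exact: finite_measure_integrable_cst.
have fE w : \prod_(i <- s) f i (X i w) = \prod_i f' i (X i w).
  rewrite big_uniq//= big_mkcond/=; apply: eq_bigr => i _.
  by rewrite /f'; case: ifP.
split.
  by under eq_fun do rewrite fE; exact: integrable_prod_indep.
under eq_Rintegral do rewrite fE.
rewrite (Rintegral_prod_indep indep mf' fi') [RHS]big_uniq//= [RHS]big_mkcond/=.
apply: eq_bigr => i _; rewrite /f'; case: ifP => // _.
by rewrite Rintegral_cst//= mul1r; move: (probability_setT P) => /= ->.
Qed.

(** * Second moments of sums *)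

Lemma integrable_sumR (R : realType) (d : measure_display)
    (T : measurableType d) (P : probability T R) (I : Type) (s : seq I)
    (F : I -> T -> R) :
  (forall i, P.-integrable setT (fun w => (F i w)%:E)) ->
  P.-integrable setT (fun w => (\sum_(i <- s) F i w)%:E).
Proof.
move=> iF; under eq_fun do rewrite -sumEFin.
by apply: (@integrable_sum _ _ _ _ _ measurableT _ _ _ (fun i w => (F i w)%:E)).
Qed.

Lemma Rintegral_sum (R : realType) (d : measure_display)
    (T : measurableType d) (P : probability T R) (I : Type) (s : seq I)
    (F : I -> T -> R) :
  (forall i, P.-integrable setT (fun w => (F i w)%:E)) ->
  \int[P]_w (\sum_(i <- s) F i w) = \sum_(i <- s) \int[P]_w F i w.
Proof.
move=> iF; elim: s => [|i s IH].
  under eq_Rintegral do rewrite big_nil.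
  by rewrite big_nil Rintegral_cst// mul0r.
under eq_Rintegral do rewrite big_cons.
rewrite big_cons RintegralD ?IH//; [exact: iF|exact: (integrable_sumR s iF)].
Qed.

(** Pythagoras in L2: the cross terms of the expanded square integrate to zero. *)
Lemma sqr_sum_orthogonal (R : realType) (d : measure_display)
    (T : measurableType d) (P : probability T R) (I : finType)
    (Z : I -> T -> R) :
  (forall i j, P.-integrable setT (fun w => (Z i w * Z j w)%:E)) ->
  (forall i j, i != j -> \int[P]_w (Z i w * Z j w) = 0) ->
  P.-integrable setT (fun w => ((\sum_i Z i w) ^+ 2)%:E) /\
  \int[P]_w ((\sum_i Z i w) ^+ 2) = \sum_i \int[P]_w (Z i w ^+ 2).
Proof.
move=> iZ oZ.
have E w : (\sum_i Z i w) ^+ 2 = \sum_i \sum_j Z i w * Z j w.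
  by rewrite expr2 big_distrlr.
have iI i : P.-integrable setT (fun w => (\sum_j Z i w * Z j w)%:E).
  exact: integrable_sumR.
split.
  by under eq_fun do rewrite E; exact: integrable_sumR.
under eq_Rintegral do rewrite E.
rewrite Rintegral_sum//; apply: eq_bigr => i _.
rewrite Rintegral_sum// (bigD1 i)//= [X in _ + X]big1 ?addr0// => j ji.
by rewrite oZ// eq_sym.
Qed.

(** Domination by [1 + x ^+ 4], distinguishing whether the absolute value of [x] exceeds 1. *)
Lemma integrable_exp_le4 (R : realType) (d : measure_display)
    (T : measurableType d) (P : probability T R) (X : {RV P >-> R}) k :
  (k <= 4)%N ->
  P.-integrable setT (fun w => ((X w) ^+ 4)%:E) ->
  P.-integrable setT (fun w => ((X w) ^+ k)%:E).
Proof.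
move=> k4 i4.
have i1 : P.-integrable setT (fun w => (1 + (X w) ^+ 4)%:E).
  apply: (integrableD measurableT (f := fun=> 1%:E)) i4 => //.
  exact: finite_measure_integrable_cst.
apply: le_integrable i1 => //.
  by apply/measurable_EFinP; exact: measurable_funX.
move=> w _; rewrite lee_fin normrX; set x := X w.
have x4 : 0 <= x ^+ 4 by exact: exprn_even_ge0.
rewrite [leRHS]ger0_norm ?addr_ge0//.
have [x1|x1] := leP `|x| 1.
  by rewrite (@le_trans _ _ 1) ?exprn_ile1 ?lerDl.
rewrite -[x ^+ 4]ger0_norm// normrX (le_trans (ler_weXn2l (ltW x1) k4))//.
by rewrite lerDr.
Qed.

(** With [A], [B], [C] the sums of [eps_a^2 - 1], [eps_b^2 - 1] and [eps_a eps_b], the second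
    moments are at most [(K - 1) m], [(K - 1) m] and [m]. Weighted by 3, 3 and 12 they add up to
    [(6 K + 6) m]. *)
Lemma sqr_pair_diff_second_moment (R : realType) (d : measure_display)
    (T : measurableType d) (P : probability T R) (I : finType)
    (X : I -> {RV P >-> R}) (K : R) (m : nat) (a b : 'I_m -> I) :
  mutually_independent X ->
  (forall i, P.-integrable setT (fun w => ((X i w) ^+ 4)%:E)) ->
  (forall i, \int[P]_w (X i w) = 0) ->
  (forall i, \int[P]_w ((X i w) ^+ 2) = 1) ->
  (forall i, \int[P]_w ((X i w) ^+ 4) <= K) ->
  injective a -> injective b -> (forall i j, a i != b j) ->
  let S w := \sum_i ((X (b i) w - X (a i) w) ^+ 2 - 2) in
  P.-integrable setT (fun w => ((S w) ^+ 2)%:E) /\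
  \int[P]_w ((S w) ^+ 2) <= (6 * K + 6) * m%:R.
Proof.
move=> indep i4 E1 E2 E4 ainj binj ab S.
have i2 i := integrable_exp_le4 (isT : (2 <= 4)%N) (i4 i).
have i1 i : P.-integrable setT (fun w => (X i w)%:E).
  exact: (integrable_exp_le4 (isT : (1 <= 4)%N) (i4 i)).
have ic (c : R) : P.-integrable setT (fun=> c%:E).
  exact: finite_measure_integrable_cst.
have Ic (c : R) : \int[P]_w c = c.
  by rewrite Rintegral_cst//= (_ : fine _ = 1) ?mulr1//; move: (probability_setT P) => /= ->.
pose u (x : R) := x ^+ 2 - 1.
have mu : measurable_fun [set: R] u.
  by apply: measurable_funB => //; exact: measurable_funX.
have iu i : P.-integrable setT (fun w => (u (X i w))%:E).
  by apply: (integrableB measurableT (i2 i) (ic 1)).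
have Eu i : \int[P]_w (u (X i w)) = 0.
  by have /= -> := RintegralB measurableT (i2 i) (ic 1); rewrite E2 Ic subrr.
have uu i : P.-integrable setT (fun w => (u (X i w) ^+ 2)%:E) /\
    \int[P]_w (u (X i w) ^+ 2) <= K - 1.
  have uE w : u (X i w) ^+ 2 = X i w ^+ 4 - (2 * X i w ^+ 2 - 1).
    by rewrite /u; ring.
  have i22 : P.-integrable setT (fun w => (2 * X i w ^+ 2)%:E).
    by apply: (integrableZl measurableT 2 (i2 i)).
  have i221 : P.-integrable setT (fun w => (2 * X i w ^+ 2 - 1)%:E).
    by apply: (integrableB measurableT i22 (ic 1)).
  split.
    under eq_fun do rewrite uE.
    by apply: (integrableB measurableT (i4 i) i221).
  under eq_Rintegral do rewrite uE.
  have /= -> := RintegralB measurableT (i4 i) i221.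
  have /= -> := RintegralB measurableT i22 (ic 1).
  have /= -> := RintegralZl 2 measurableT (i2 i).
  rewrite E2 Ic.
  have := E4 i; lra.
have A2 (c : 'I_m -> I) : injective c ->
    P.-integrable setT (fun w => ((\sum_i u (X (c i) w)) ^+ 2)%:E) /\
    \int[P]_w ((\sum_i u (X (c i) w)) ^+ 2) <= (K - 1) * m%:R.
  move=> cinj.
  have cc i j : i != j -> 
      P.-integrable setT (fun w => (u (X (c i) w) * u (X (c j) w))%:E) /\
      \int[P]_w (u (X (c i) w) * u (X (c j) w)) = 0.
    move=> ij; have us : uniq [:: c i; c j] by rewrite /= inE (inj_eq cinj) ij.
    have [p1 p2] := prod_seq_indep (f := fun=> u) indep us (fun=> mu) iu.
    have E w : u (X (c i) w) * u (X (c j) w) =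
       \prod_(k <- [:: c i; c j]) u (X k w) by rewrite !big_cons big_nil mulr1.
    split; first by under eq_fun do rewrite E.
    by under eq_Rintegral do rewrite E; rewrite p2 !big_cons Eu mul0r.
  have [] := @sqr_sum_orthogonal _ _ _ P _ (fun i w => u (X (c i) w)).
  - move=> i j; have [->|ij] := eqVneq i j; last by have [] := cc _ _ ij.
    by under eq_fun do rewrite -expr2; have [] := uu (c j).
  - by move=> i j /cc[].
  move=> ? ->; split => //; rewrite -[m in leRHS]card_ord mulr_natr -sumr_const.
  by apply: ler_sum => i _; have [] := uu (c i).
have [iA EA] := A2 _ ainj; have [iB EB] := A2 _ binj.
have [iC EC] : P.-integrable setT (fun w => ((\sum_i X (a i) w * X (b i) w) ^+ 2)%:E) /\
    \int[P]_w ((\sum_i X (a i) w * X (b i) w) ^+ 2) = m%:R.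
  have diag i : P.-integrable setT (fun w => ((X (a i) w * X (b i) w) ^+ 2)%:E) /\
      \int[P]_w ((X (a i) w * X (b i) w) ^+ 2) = 1.
    have us : uniq [:: a i; b i] by rewrite /= inE ab.
    have [p1 p2] := prod_seq_indep (f := fun _ x => x ^+ 2) indep us
      (fun=> measurable_funX 2 (@measurable_id _ _ _)) i2.
    have E w : (X (a i) w * X (b i) w) ^+ 2 =
       \prod_(k <- [:: a i; b i]) X k w ^+ 2.
      by rewrite !big_cons big_nil mulr1 exprMn.
    split; first by under eq_fun do rewrite E.
    by under eq_Rintegral do rewrite E; rewrite p2 !big_cons big_nil !E2 !mulr1.
  have off i j : i != j ->
      P.-integrable setT (fun w => (X (a i) w * X (b i) w * (X (a j) w * X (b j) w))%:E) /\
      \int[P]_w (X (a i) w * X (b i) w * (X (a j) w * X (b j) w)) = 0.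
    (* For distinct pairs the four indices are distinct, so the expectation factors and contains a
       vanishing mean. *)
    move=> ij; have us : uniq [:: a i; b i; a j; b j].
      rewrite /= !inE !negb_or !ab (inj_eq ainj) (inj_eq binj) ij.
      by rewrite eq_sym ab.
    have [p1 p2] := prod_seq_indep (f := fun _ x => x) indep us
      (fun=> @measurable_id _ _ _) i1.
    have E w : X (a i) w * X (b i) w * (X (a j) w * X (b j) w) =
       \prod_(k <- [:: a i; b i; a j; b j]) X k w.
      by rewrite !big_cons big_nil mulr1 !mulrA.
    split; first by under eq_fun do rewrite E.
    by under eq_Rintegral do rewrite E; rewrite p2 !big_cons E1 mul0r.
  have [] := @sqr_sum_orthogonal _ _ _ P _ (fun i w => X (a i) w * X (b i) w).
  - move=> i j; have [->|ij] := eqVneq i j; last by have [] := off _ _ ij.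
    by under eq_fun do rewrite -expr2; have [] := diag j.
  - by move=> i j /off[].
  move=> ? ->; split => //; rewrite (eq_bigr (fun=> 1)); last by move=> i _; have [] := diag i.
  by rewrite sumr_const card_ord.
set A := (fun w => \sum_i u (X (a i) w)) in iA EA.
set B := (fun w => \sum_i u (X (b i) w)) in iB EB.
set C := (fun w => \sum_i X (a i) w * X (b i) w) in iC EC.
have SE w : S w = A w + B w - 2 * C w.
  rewrite /S /A /B /C mulr_sumr -big_split/= -sumrB; apply: eq_bigr => i _.
  by rewrite /u; ring.
pose D w := 3 * A w ^+ 2 + 3 * B w ^+ 2 + 12 * C w ^+ 2.
have SD w : S w ^+ 2 <= D w.
  rewrite SE /D; move: (A w) (B w) (C w) => x y z.
  (* The sum of these three squares is exactly [D w - S w ^+ 2]. *)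
  have := sqr_ge0 (x - y); have := sqr_ge0 (x + 2 * z); have := sqr_ge0 (y + 2 * z).
  nra.
have iA' : P.-integrable setT (fun w => (3 * A w ^+ 2)%:E).
  exact: (integrableZl measurableT 3 iA).
have iB' : P.-integrable setT (fun w => (3 * B w ^+ 2)%:E).
  exact: (integrableZl measurableT 3 iB).
have iC' : P.-integrable setT (fun w => (12 * C w ^+ 2)%:E).
  exact: (integrableZl measurableT 12 iC).
have iAB : P.-integrable setT (fun w => (3 * A w ^+ 2 + 3 * B w ^+ 2)%:E).
  exact: (integrableD measurableT iA' iB').
have iD : P.-integrable setT (fun w => (D w)%:E).
  exact: (integrableD measurableT iAB iC').
have iS : P.-integrable setT (fun w => ((S w) ^+ 2)%:E).
  apply: le_integrable iD => //.
    apply/measurable_EFinP/measurable_funX/measurable_sum => i.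
    apply: measurable_funB => //; apply: measurable_funX.
    exact: measurable_funB.
  by move=> w _; rewrite lee_fin ger0_norm ?sqr_ge0// (le_trans (SD w))// ler_norm.
split => //; apply: (le_trans (le_Rintegral measurableT iS iD (fun w _ => SD w))).
have /= -> := RintegralD measurableT iAB iC'.
have /= -> := RintegralD measurableT iA' iB'.
have /= -> := RintegralZl 3 measurableT iA.
have /= -> := RintegralZl 3 measurableT iB.
have /= -> := RintegralZl 12 measurableT iC.
rewrite EC.
nra.
Qed.

(** * Tail bounds *)

(** Chebyshev's inequality, from [c ^+ 2] times the indicator of the event being at most
    [S ^+ 2]. *)
Lemma second_moment_tail (R : realType) (d : measure_display)
    (T : measurableType d) (P : probability T R) (S : T -> R) (M c : R) :
  0 < c -> measurable_fun setT S ->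
  P.-integrable setT (fun w => ((S w) ^+ 2)%:E) ->
  \int[P]_w ((S w) ^+ 2) <= M ->
  (P [set w | (c < `|S w|)%R] <= (M / c ^+ 2)%:E)%E.
Proof.
move=> c0 mS iS SM; set A := [set w | _].
have mA : measurable A.
  rewrite -[A]setTI; apply: (measurable_fun_ltr (f := fun=> c)) => //.
  exact: measurableT_comp.
have c20 : 0 < c ^+ 2 by rewrite exprn_gt0.
rewrite EFinM -[P A]mule1 -[1%E](_ : (c ^+ 2)%:E * ((c ^+ 2)^-1)%:E = 1)%E; last first.
  by rewrite -EFinM divff// gt_eqF.
rewrite muleA; apply: lee_wpmul2r; first by rewrite lee_fin invr_ge0 ltW.
apply: (@le_trans _ _ (\int[P]_w ((S w) ^+ 2)%:E)%E); last first.
  by rewrite -[leLHS]fineK ?lee_fin// integrable_fin_num.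
have m1A : measurable_fun [set: T] (fun w => (\1_A w : R)%:E).
  by apply/measurable_EFinP; exact: measurable_indic.
rewrite muleC -[X in P X]setIT -integral_indic//.
rewrite -(ge0_integralZl_EFin P measurableT _ m1A (ltW c20)); last first.
  by move=> w _; rewrite lee_fin.
apply: ge0_le_integral => //.
- by move=> w _; rewrite -EFinM lee_fin mulr_ge0// ltW.
- exact: measurable_funeM.
- by apply/measurable_EFinP; exact: measurable_funX.
move=> w _; rewrite -EFinM lee_fin indicE; case: (boolP (w \in A)) => [|_].
  rewrite inE /A/= mulr1 => cS; rewrite -[leRHS]real_normK ?num_real//.
  by rewrite ler_sqr ?nnegrE// ltW.
by rewrite mulr0 sqr_ge0.
Qed.

(** Conditioning on [s]: by independence each value [x] contributes at most [p] times its
    probability, and these probabilities sum to 1. The finite list [L] of values makes the event a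
    finite union. *)
Lemma discrete_mixture_le (R : realType) (d d' : measure_display)
    (T : measurableType d) (P : probability T R) (S : countType) (s : T -> S)
    (U : measurableType d') (Y : T -> U) (L : seq S) (B : S -> set U)
    (p : \bar R) :
  discrete_independent P s Y -> measurable_fun setT Y ->
  (forall w, s w \in L) -> (forall x, measurable (B x)) -> (0 <= p)%E ->
  (forall x, x \in L -> P (Y @^-1` B x) <= p)%E ->
  measurable [set w | B (s w) (Y w)] /\ (P [set w | B (s w) (Y w)] <= p)%E.
Proof.
move=> [ms indep] mY sL mB p0 Bp.
have E (A : S -> set T) : [set w | A (s w) w] =
    \bigcup_(x in [set` L]) ([set w | s w = x] `&` A x).
  apply/seteqP; split => w /=; first by move=> h; exists (s w) => //=.
  by move=> [x _ [/= <-]].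
have mYB x : measurable (Y @^-1` B x) by rewrite -[X in measurable X]setTI; exact: mY.
have fL : finite_set [set` L] by exact: finite_seq.
have mu (A : S -> set T) : (forall x, measurable (A x)) ->
    P [set w | A (s w) w] =
    (\sum_(x \in [set` L]) P ([set w | s w = x] `&` A x))%E.
  move=> mA; rewrite E measure_fin_bigcup//.
    by move=> x y _ _ [w [[/= <- _] [/= <- _]]].
  by move=> x _; exact: measurableI.
split.
  rewrite (E (fun x => Y @^-1` B x)); apply: fin_bigcup_measurable => // x _.
  exact: measurableI.
rewrite (mu (fun x => Y @^-1` B x))//.
apply: (@le_trans _ _ (\sum_(x \in [set` L]) (p * P [set w | s w = x]))%E).
  apply: lee_fsum => // x xL; rewrite indep//.
  by rewrite muleC lee_wpmul2r//; exact: Bp.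
rewrite -ge0_mule_fsumr//.
(* With the full event for every value this says that the probabilities of the values of [s] sum to
   1. *)
have := mu (fun=> setT) (fun=> measurableT).
rewrite (_ : [set w | _] = setT); last by apply/seteqP; split.
rewrite probability_setT; under eq_fsbigr do rewrite setIT.
by move=> <-; rewrite mule1.
Qed.

(** * Deterministic error of the estimator for a fixed search order *)

Lemma norm_col_leP (R : realType) (n : nat) (x : 'cV[R]_n) (c : R) :
  0 <= c -> reflect (forall i, `|x i 0| <= c) (`|x| <= c).
Proof.
move=> c0; rewrite [`|x|]mx_normrE; apply: (iffP (bigmax_leP _ _ _ _)) => [[_ h] i|h].
  exact: (h (i, 0)).
by split=> // -[i j] _ /=; rewrite (ord1 j).
Qed.

(** Shifts the pairs [(2i - 1, 2i)] counted from 1 to positions [2i] and [2i + 1] counted from 0. As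
    [2 * m <= n], no default value of [nth] is read. *)
Lemma dfs_varianceE (R : realType) (n : nat) (x0 : 'I_n) (y : n.-tuple R)
    (s : seq 'I_n) (m := (n./2 - 1)%N) :
  size s = n ->
  dfs_variance y s = (2 * m%:R)^-1 * \sum_(i < m)
    (tnth y (nth x0 s (2 * i).+1) - tnth y (nth x0 s (2 * i))) ^+ 2.
Proof.
move=> sn; rewrite /dfs_variance -/m; congr (_ * _).
rewrite big_add1 big_mkord; apply: eq_bigr => i _.
have im : (i < m)%N by [].
have mn : (2 * m <= n)%N by rewrite /m; lia.
have -> : (2 * i.+1).-1 = (2 * i).+1 by lia.
have -> : (2 * i.+1 - 1).-1 = (2 * i)%N by lia.
by rewrite !(nth_map x0) ?sn//; lia.
Qed.

(** The factor 4 is a product of two twos: differences of entries are at most twice the sup norm,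
    and the increments of [theta] along the pairs sum to at most twice its total variation. *)
Lemma dfs_variance_error (R : realType) (n : nat) (e : rel 'I_n)
    (theta v eps : 'cV[R]_n) (v0 c : R) (x0 : 'I_n) (s : seq 'I_n)
    (m := (n./2 - 1)%N) :
  connected_graph e -> dfs_order e s -> (0 < m)%N -> 0 <= v0 ->
  (forall i, v i 0 = v0) -> `|eps| <= c ->
  `|v0 - dfs_variance (observations theta v eps) s| <=
  (2 * m%:R)^-1 * (`|\sum_(i < m) (v0 * (
      (eps (nth x0 s (2 * i).+1) 0 - eps (nth x0 s (2 * i)) 0) ^+ 2 - 2))| +
    4 * (`|theta| + 2 * (Num.sqrt v0 * c)) * l1norm (incidence R e *m theta)).
Proof.
move=> ce ds m0 v00 vE ec.
have [esym eirr _] := ce.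
have ps := dfs_order_perm ce ds.
have sn : size s = n by rewrite (perm_size ps) -cardT card_ord.
have c0 : 0 <= c by apply: le_trans ec.
have mR : 0 < m%:R :> R by rewrite ltr0n.
have mn : (2 * m <= n)%N by rewrite /m; lia.
set r := Num.sqrt v0; have r0 : 0 <= r by exact: sqrtr_ge0.
have r2 : r ^+ 2 = v0 by exact: sqr_sqrtr.
set a := fun i : 'I_m => nth x0 s (2 * i).
set b := fun i : 'I_m => nth x0 s (2 * i).+1.
have tv : \sum_(i < m) `|theta (b i) 0 - theta (a i) 0| <=
    l1norm (incidence R e *m theta) *+ 2.
  rewrite -sum_edge_tv//.
  apply: le_trans (sum_pairs_le_dfs (fun i => theta i 0) ce ds _); last first.
    by rewrite card_ord; exact: mn.
  rewrite big_mkord; apply: ler_sum => i _; have im : (i < m)%N by [].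
  by rewrite !(nth_map x0) ?sn//; lia.
rewrite (dfs_varianceE x0)// -/m.
(* Writing [v0] as an average over the pairs allows a termwise subtraction. *)
rewrite [X in `|X - _|](_ : v0 = (2 * m%:R)^-1 * \sum_(i < m) (2 * v0)); last first.
  by rewrite sumr_const card_ord -mulr_natr; field; rewrite gt_eqF.
rewrite -mulrBr normrM ger0_norm ?invr_ge0 ?mulr_ge0// ler_wpM2l ?invr_ge0 ?mulr_ge0//.
rewrite -sumrB.
pose dt i := theta (b i) 0 - theta (a i) 0.
pose de i := eps (b i) 0 - eps (a i) 0.
(* Expands [2 v0 - (dt + r de)^2] with [r^2 = v0]: a pure noise term, and a term with the factor
   [dt]. *)
rewrite (eq_bigr (fun i => - (v0 * (de i ^+ 2 - 2)) - dt i * (dt i + 2 * (r * de i)))); last first.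
  move=> i _; rewrite !tnth_mktuple !vE -/r -/(a i) -/(b i) -r2 /dt /de; ring.
rewrite sumrB sumrN (le_trans (ler_normB _ _))// normrN.
rewrite lerD2l (le_trans (ler_norm_sum _ _ _))//.
have B i : `|dt i * (dt i + 2 * (r * de i))| <= `|dt i| * (2 * (`|theta| + 2 * (r * c))).
  rewrite normrM ler_wpM2l// (le_trans (ler_normD _ _))//.
  have nd (x : 'cV[R]_n) k l j : `|x| <= k -> `|x l 0 - x j 0| <= 2 * k.
    move=> xk; have k0 : 0 <= k by exact: le_trans xk.
    move/(norm_col_leP _ k0) : xk => xk.
    by rewrite (le_trans (ler_normB _ _))// mulr_natl mulr2n lerD.
  rewrite [leRHS]mulrDr lerD//; first exact: nd.
  rewrite normrM (ger0_norm (_ : 0 <= 2))// ler_wpM2l// normrM ger0_norm//.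
  by rewrite mulrCA ler_wpM2l//; exact: nd.
rewrite (le_trans (ler_sum _ (fun i _ => B i)))// -mulr_suml.
rewrite [leRHS](_ : _ =
  (l1norm (incidence R e *m theta) *+ 2) * (2 * (`|theta| + 2 * (r * c)))); last by ring.
by rewrite ler_wpM2r// mulr_ge0// addr_ge0// mulr_ge0// mulr_ge0.
Qed.

(** * Probability of a large error *)

Lemma fourth_moment_integrable (R : realType) (d : measure_display)
    (T : measurableType d) (P : probability T R) (X : {RV P >-> R}) (K : R) :
  ('E_P[fun w => ((X w) ^+ 4)%R] <= K%:E)%E ->
  P.-integrable setT (fun w => ((X w) ^+ 4)%:E) /\
  \int[P]_w ((X w) ^+ 4) <= K.
Proof.
rewrite unlock => h.
have i4 : P.-integrable setT (fun w => ((X w) ^+ 4)%:E).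
  apply/integrableP; split; first by apply/measurable_EFinP; exact: measurable_funX.
  apply: le_lt_trans (ltry K); apply: le_trans h.
  rewrite le_eqVlt; apply/orP; left; apply/eqP; apply: eq_integral => w _.
  by rewrite gee0_abs// lee_fin exprn_even_ge0.
by split => //; rewrite -lee_fin fineK// integrable_fin_num.
Qed.

Lemma sqr_moment_of_variance (R : realType) (d : measure_display)
    (T : measurableType d) (P : probability T R) (X : {RV P >-> R}) :
  ('E_P[X] = 0)%E -> ('V_P[X] = 1)%E -> \int[P]_w ((X w) ^+ 2) = 1.
Proof.
move=> E0; rewrite /variance covariance.unlock E0 /= unlock => V1.
rewrite /Rintegral (_ : (\int[P]_w _ = 1)%E)//= -V1.
by apply: eq_integral => w _ /=; rewrite fctE/= !subr0 expr2.
Qed.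

Lemma measurable_lt_norm_col (R : realType) (d : measure_display)
    (T : measurableType d) (P : probability T R) (n : nat)
    (eps : 'I_n -> {RV P >-> R}) (c : R) :
  0 <= c -> measurable [set w | c < `|\col_(i < n) eps i w|].
Proof.
move=> c0.
rewrite (_ : [set w | _] = \bigcup_(i in [set: 'I_n]) [set w | c < `|eps i w|]).
  apply: fin_bigcup_measurable => [|i _]; first exact: finite_finset.
  rewrite -[X in measurable X]setTI.
  apply: (measurable_fun_ltr (f := fun=> c) (g := fun w => `|eps i w|)) => //.
  exact: measurableT_comp.
apply/seteqP; split => w /=; last first.
  move=> [i _ /=]; rewrite !ltNge; apply: contra => /(norm_col_leP _ c0)/(_ i).
  by rewrite mxE.
rewrite ltNge => /(norm_col_leP _ c0)/existsNP[i]; rewrite mxE => h.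
by exists i => //=; rewrite ltNge; apply/negP.
Qed.

(** A large error forces one of two bad events: the noise exceeds [C1 * U], or the centred noise
    average is large. [C2] controls the latter; 10 and [20 * C1] are the coefficients of the [theta]
    and [U] terms once [m] is replaced by [n]. *)
Lemma dfs_variance_tail (R : realType) (d : measure_display)
    (T : measurableType d) (P : probability T R) (n : nat) (e : rel 'I_n)
    (theta v : 'cV[R]_n) (v0 U K C1 C2 : R) (eps : 'I_n -> {RV P >-> R})
    (sigma : T -> seq 'I_n)
    (epsv := fun w : T => \col_(i < n) eps i w)
    (y := fun w : T => observations theta v (epsv w)) :
  large n -> connected_graph e -> 0 <= v0 -> mutually_independent eps ->
  (forall i, ('E_P[eps i] = 0)%E) -> (forall i, ('V_P[eps i] = 1)%E) ->
  (forall w, dfs_order e (sigma w)) -> discrete_independent P sigma y ->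
  (forall i, v i 0 = v0) -> 0 <= K ->
  (forall i, ('E_P[fun w => ((eps i w) ^+ 4)%R] <= K%:E)%E) ->
  0 < U -> 0 < C1 -> 0 < C2 ->
  (P [set w | ((C2 + 10 + 20 * C1) * (v0 / Num.sqrt n%:R +
      (U * Num.sqrt v0 + `|theta|) * l1norm (incidence R e *m theta) / n%:R)
    < `|v0 - dfs_variance (y w) (sigma w)|)%R] <=
  P [set w | (C1 * U < `|epsv w|)%R] + (8 * (K + 1) / C2 ^+ 2)%:E)%E.
Proof.
move=> ln ce v00 indep E0 V1 ds dind vE K0 E4 U0 C10 C20.
set L1 := l1norm _; set C := C2 + _ + _; set an := v0 / _ + _.
pose m := (n./2 - 1)%N; have m0 : (0 < m)%N by [].
have n4 : (4 <= n)%N by move: m0; rewrite /m; lia.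
have mn : (2 * m <= n)%N by rewrite /m; lia.
(* The ratio 5 is attained at [n = 5], where [m = 1]. *)
have nm : (n <= 5 * m)%N by move: m0; rewrite /m; lia.
have x0 : 'I_n by exists 0%N; lia.
have mR : 0 < m%:R :> R by rewrite ltr0n.
have nR : 0 < n%:R :> R by rewrite ltr0n; lia.
have nmR : n%:R <= 5 * m%:R :> R by rewrite -natrM ler_nat.
have sn0 : 0 < Num.sqrt n%:R :> R by rewrite sqrtr_gt0.
have L10 : 0 <= L1 by rewrite sumr_ge0.
(* Chosen so that the normalised threshold [(2 m)^-1 c v0] equals [C2 v0 / sqrt n]. *)
pose c : R := C2 * (2 * m%:R) / Num.sqrt n%:R.
have c0 : 0 < c by rewrite divr_gt0// mulr_gt0// mulr_gt0.
have my : measurable_fun setT y.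
  apply/measurable_fun_tnthP => i.
  rewrite (_ : _ \o _ = fun w => theta i 0 + Num.sqrt (v i 0) * eps i w); last first.
    by apply/funext => w; rewrite /= tnth_mktuple mxE.
  by apply: measurable_funD => //; exact: measurable_funM.
pose a (s : seq 'I_n) (i : 'I_m) := nth x0 s (2 * i).
pose b (s : seq 'I_n) (i : 'I_m) := nth x0 s (2 * i).+1.
pose S s w := \sum_(i < m) ((eps (b s i) w - eps (a s i) w) ^+ 2 - 2).
(* Independence of [sigma] is assumed from the observations, not from the noise, so the noise sum
   [v0 * S] is recovered as a function of [y] by subtracting the increments of [theta]. *)
pose g s (z : n.-tuple (measurableTypeR R)) : R := \sum_(i < m)
  ((tnth z (b s i) - tnth z (a s i) - (theta (b s i) 0 - theta (a s i) 0)) ^+ 2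
   - 2 * v0).
have gE s w : g s (y w) = v0 * S s w.
  rewrite mulr_sumr; apply: eq_bigr => i _; rewrite !tnth_mktuple !mxE !vE.
  rewrite -{3 4}(sqr_sqrtr v00); ring.
have mg s : measurable_fun setT (g s).
  apply: measurable_sum => i; apply: measurable_funB => //; apply: measurable_funX.
  apply: measurable_funB => //; apply: measurable_funB; exact: measurable_tnth.
pose L := permutations (enum 'I_n).
have sL w : sigma w \in L.
  by rewrite mem_permutations; exact: dfs_order_perm ce (ds w).
pose B s := [set z : n.-tuple (measurableTypeR R) | c * v0 < `|g s z|].
have mB s : measurable (B s).
  rewrite -[X in measurable X]setTI.
  apply: (measurable_fun_ltr (f := fun=> c * v0) (g := fun z => `|g s z|)) => //.
  exact: measurableT_comp.
have p0 : (0 <= (8 * (K + 1) / C2 ^+ 2)%:E :> \bar R)%E.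
  by rewrite lee_fin divr_ge0// ?sqr_ge0// mulr_ge0// addr_ge0.
have PB s : s \in L -> (P (y @^-1` B s) <= (8 * (K + 1) / C2 ^+ 2)%:E)%E.
  rewrite mem_permutations => ps.
  have us : uniq s by rewrite (perm_uniq ps) enum_uniq.
  have sn : size s = n by rewrite (perm_size ps) -cardT card_ord.
  have ltm (i : 'I_m) : ((2 * i).+1 < size s)%N.
    by have := ltn_ord i; rewrite sn; move: mn; clear; lia.
  have ltm' (i : 'I_m) : (2 * i < size s)%N by exact: ltnW.
  have inj k l : (k < size s)%N -> (l < size s)%N ->
      nth x0 s k = nth x0 s l -> k = l.
    by move=> ks ls /eqP; rewrite nth_uniq// => /eqP.
  have ainj : injective (a s).
    move=> i j /inj-/(_ (ltm' i) (ltm' j)) ij; apply: val_inj.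
    by move: ij; clear; rewrite /=; lia.
  have binj : injective (b s).
    move=> i j /inj-/(_ (ltm i) (ltm j)) ij; apply: val_inj.
    by move: ij; clear; rewrite /=; lia.
  have ab i j : a s i != b s j.
    apply/eqP => /inj-/(_ (ltm' i) (ltm j)); clear; lia.
  have h4 i := fourth_moment_integrable (E4 i).
  have E0' i : \int[P]_w eps i w = 0.
    by rewrite /Rintegral; have := E0 i; rewrite unlock => ->.
  have [iS ES] := sqr_pair_diff_second_moment indep (fun i => (h4 i).1) E0'
    (fun i => sqr_moment_of_variance (E0 i) (V1 i)) (fun i => (h4 i).2) ainj binj ab.
  have mS : measurable_fun setT (S s).
    apply: measurable_sum => i; apply: measurable_funB => //; apply: measurable_funX.
    exact: measurable_funB.
  (* If [v0] vanishes the strict inequality defining the event fails everywhere; otherwise [v0] is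
     cancelled. *)
  have [v0E|vpos] := eqVneq v0 0.
    rewrite (_ : _ @^-1` _ = set0) ?measure0//; apply/seteqP; split => // w.
    by rewrite /B/= gE v0E mul0r normr0 mulr0 ltxx.
  have {}vpos : 0 < v0 by rewrite lt0r vpos.
  rewrite (_ : _ @^-1` _ = [set w | c < `|S s w|]); last first.
    apply/seteqP; split => w; rewrite /B/= gE normrM (ger0_norm v00) mulrC ltr_pM2l//.
  apply: (le_trans (second_moment_tail c0 mS iS ES)).
  rewrite lee_fin ler_pdivrMr ?exprn_gt0//.
  (* With [q = m^2 / n] the goal is [(6 K + 6) m <= 32 (K + 1) q]; since [m <= 5 q] the left side is
     at most [30 (K + 1) q], hence the constant 8. *)
  have -> : 8 * (K + 1) / C2 ^+ 2 * c ^+ 2 = 8 * (K + 1) * (4 * (m%:R ^+ 2 / n%:R)).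
    rewrite -(@sqr_sqrtr _ (n%:R : R)) ?ltW// /c; field.
    by rewrite !gt_eqF.
  set q := m%:R ^+ 2 / n%:R.
  have q0 : 0 <= q by rewrite divr_ge0// ?sqr_ge0// ltW.
  have mq : m%:R <= 5 * q.
    rewrite /q mulrA ler_pdivlMr// mulrC.
    by have := ler_wpM2r (ltW mR) nmR; rewrite -mulrA -expr2.
  have := mulr_ge0 (addr_ge0 K0 ler01) q0.
  have : 0 <= (K + 1) * (5 * q - m%:R) by apply: mulr_ge0; rewrite ?subr_ge0 ?addr_ge0.
  lra.
have [mBad PBad] := discrete_mixture_le dind my sL mB p0 PB.
have mA := measurable_lt_norm_col eps (ltW (mulr_gt0 C10 U0)).
(* Monotonicity of the measure needs this event measurable; the mixture lemma gives it, with the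
   trivial bound 1. *)
have mE : measurable [set w | C * an < `|v0 - dfs_variance (y w) (sigma w)|].
  pose F s := [set z : n.-tuple (measurableTypeR R) |
    C * an < `|v0 - dfs_variance z s|].
  have mF s : measurable (F s).
    rewrite -[X in measurable X]setTI.
    apply: (measurable_fun_ltr (f := fun=> C * an)
      (g := fun z : n.-tuple (measurableTypeR R) => `|v0 - dfs_variance z s|)) => //.
    apply: measurableT_comp => //; apply: measurable_funB => //.
    apply: measurable_funM => //; apply: measurable_sum => i; apply: measurable_funX.
    have mz k : measurable_fun setT (fun z : n.-tuple (measurableTypeR R) =>
        [seq tnth z j | j <- s]`_k).
      have [ks|ks] := ltnP k (size s); last first.
        by under eq_fun do rewrite nth_default ?size_map//; exact: measurable_cst.
      under eq_fun do rewrite (nth_map x0)//; exact: measurable_tnth.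
    by apply: measurable_funB.
  have [] := discrete_mixture_le (p := 1%E) dind my sL mF => //.
  by move=> s _; apply: probability_le1; rewrite -[X in measurable X]setTI; exact: my.
apply: (@le_trans _ _ (P ([set w | C1 * U < `|epsv w|] `|` [set w | B (sigma w) (y w)]))).
  apply: le_measure; rewrite ?inE//; first exact: measurableU.
  move=> w /= Ew; apply: contrapT => /not_orP[/negP]; rewrite -leNgt => eC.
  rewrite /B/= => /negP; rewrite -leNgt gE => gc.
  move: Ew; apply/negP; rewrite -leNgt.
  have := dfs_variance_error theta x0 ce (ds w) m0 v00 vE eC.
  move/le_trans; apply.
  under eq_bigr do rewrite !mxE.
  rewrite -mulr_sumr -/(S _ _) -/L1 -/m.
  have i2m : 0 <= (2 * m%:R)^-1 :> R by rewrite invr_ge0 mulr_ge0// ltW.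
  have im : (2 * m%:R)^-1 <= 5 / (2 * n%:R) :> R.
    rewrite ler_pdivlMr ?mulr_gt0// mulrC ler_pdivrMr ?mulr_gt0//.
    by move: nmR; lra.
  have W0 : 0 <= 4 * (`|theta| + 2 * (Num.sqrt v0 * (C1 * U))) * L1.
    by rewrite mulr_ge0// mulr_ge0// addr_ge0// !mulr_ge0 ?sqrtr_ge0// ltW.
  rewrite mulrDr.
  apply: (le_trans (lerD (ler_wpM2l i2m gc) (ler_wpM2r W0 im))).
  rewrite /an [leRHS]mulrDr lerD//.
    have -> : (2 * m%:R)^-1 * (c * v0) = C2 * (v0 / Num.sqrt n%:R).
      by rewrite /c; field; rewrite !gt_eqF.
    have CC2 : C2 <= C by rewrite /C; clear -C10; lra.
    by apply: ler_wpM2r => //; rewrite divr_ge0 ?sqrtr_ge0.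
  rewrite [leLHS](_ : _ =
      10 * (2 * C1 * (U * Num.sqrt v0) + `|theta|) * (L1 / n%:R)); last first.
    by field; rewrite gt_eqF.
  rewrite [leRHS](_ : _ = C * (U * Num.sqrt v0 + `|theta|) * (L1 / n%:R)); last first.
    by rewrite !mulrA.
  apply: ler_wpM2r; first by rewrite divr_ge0.
  have x0' : 0 <= U * Num.sqrt v0 by rewrite mulr_ge0 ?sqrtr_ge0// ltW.
  have t0 : 0 <= `|theta| by [].
  have := mulr_ge0 (ltW C10) x0'; have := mulr_ge0 (ltW C10) t0.
  have := mulr_ge0 (ltW C20) x0'; have := mulr_ge0 (ltW C20) t0.
  rewrite /C; lra.
apply: (le_trans (measureU2 _ _ _)) => //.
by rewrite leeD2l.
Qed.

Theorem theorem1 (R : realType)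
    (d : nat -> measure_display)
    (T : forall n, measurableType (d n))
    (P : forall n, probability (T n) R)
    (e : forall n, rel 'I_n)
    (theta v : forall n, 'cV[R]_n)
    (v0 U : nat -> R)
    (eps : forall n, 'I_n -> {RV (P n) >-> R})
    (sigma : forall n, T n -> seq 'I_n)
    (epsv := fun n (w : T n) => \col_(i < n) eps n i w)
    (y := fun n (w : T n) => observations (theta n) (v n) (epsv n w)) :
  (forall n, large n -> connected_graph (e n)) ->
  (forall n, large n -> forall i, 0 <= v n i 0) ->
  (forall n, large n -> mutually_independent (eps n)) ->
  (forall n, large n -> forall i, ('E_(P n)[eps n i] = 0)%E) ->
  (forall n, large n -> forall i, ('V_(P n)[eps n i] = 1)%E) ->
  (forall n, large n -> forall w, dfs_order (e n) (sigma n w)) ->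
  (forall n, large n -> discrete_independent (P n) (sigma n) (y n)) ->
  (forall n, large n -> forall i, v n i 0 = v0 n) ->
  (exists K : R, forall n, large n ->
    (\big[maxe/-oo]_(i < n) 'E_(P n)[fun w => ((eps n i w) ^+ 4)%R] <= K%:E)%E) ->
  (forall n, large n -> 0 < U n) ->
  Opr large P (fun n w => `|epsv n w|) U ->
  Opr large P (fun n w => `|v0 n - dfs_variance (y n w) (sigma n w)|)
    (fun n => v0 n / Num.sqrt n%:R +
      (U n * Num.sqrt (v0 n) + `|theta n|) *
        l1norm (incidence R (e n) *m theta n) / n%:R).
Proof.
move=> ce vpos indep E0 V1 ds dind vE [K HK] U0 HU t t0.
(* Half of [t] goes to the noise bound, the other half to the Chebyshev term. *)
have [C1 C10 HC1] := HU (t / 2) (divr_gt0 t0 (ltr0n _ 2)).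
pose M := 8 * (`|K| + 1).
have M0 : 0 < M by rewrite mulr_gt0// ltr_wpDl.
(* [C2 >= 1] and [C2 > 2 M / t] give [M / C2^2 <= M / C2 < t / 2]. Like [C1], it is fixed before
   [n]. *)
pose C2 := 1 + 2 * M / t.
have C20 : 0 < C2 by apply: addr_gt0 => //; rewrite divr_gt0// mulr_gt0.
exists (C2 + 10 + 20 * C1); first by have := mulr_gt0 (ltr0n R 20) C10; lra.
move=> n ln.
have v00 : 0 <= v0 n.
  have n0 : (0 < n)%N by move: ln; rewrite /large; lia.
  by rewrite -(vE n ln (Ordinal n0)); exact: vpos.
(* [K] comes without a sign, whereas the tail bound asks for a nonnegative constant; hence its
   absolute value. *)
have E4 i : ('E_(P n)[fun w => ((eps n i w) ^+ 4)%R] <= `|K|%:E)%E.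
  have /bigmax_leP[_ /(_ i isT) h] := HK n ln.
  by apply: (le_trans h); rewrite lee_fin ler_norm.
apply: (le_lt_trans (dfs_variance_tail ln (ce n ln) v00 (indep n ln) (E0 n ln)
  (V1 n ln) (ds n ln) (dind n ln) (vE n ln) (normr_ge0 K) E4 (U0 n ln) C10 C20)).
rewrite [t]splitr EFinD; apply: lteD; first exact: HC1.
rewrite lte_fin -/M ltr_pdivrMr ?exprn_gt0//.
have : t * C2 = t + 2 * M by rewrite /C2 mulrDr mulr1 mulrC divfK ?gt_eqF.
have C21 : 1 <= C2 by rewrite lerDl divr_ge0// ?mulr_ge0// ltW.
nra.
Qed.
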